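(* Let $X$ and $Y$ be Banach spaces. If $T\in\mathrm{QNA}(X,Y)$ satisfies that $T(X)$ is closed and $\ker T$ is proximinal in $X$, then $T\in\mathrm{NA}(X,Y)$.
   Context: Banach spaces are over $\mathbb{K}=\mathbb{R}$ or $\mathbb{C}$; $B_X$ is the closed unit ball of $X$. For a bounded linear operator $T\colon X\to Y$: $T\in\mathrm{NA}(X,Y)$ if $\|Tx_0\|=\|T\|$ for some $x_0\in B_X$; $T\in\mathrm{QNA}(X,Y)$ if there is $u\in\overline{T(B_X)}$ (norm closure) with $\|u\|=\|T\|$. A closed subspace $Z$ of a Banach space $X$ is proximinal if for every $x\in X$ there is $z\in Z$ with $\|x-z\|=\mathrm{dist}(x,Z)$. *)

(* Defs.v *)
From HB Require Import structures.
From mathcomp Require Import all_boot all_order all_algebra.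
From mathcomp Require Import all_classical all_reals topology normedtype.
From mathcomp Require Export complex.

Set Implicit Arguments.
Unset Strict Implicit.
Unset Printing Implicit Defensive.

Import Order.TTheory GRing.Theory Num.Theory.
Import numFieldNormedType.Exports.

Local Open Scope classical_set_scope.
Local Open Scope ring_scope.

Variant scalar_field (R : realType) : numFieldType -> Prop :=
| Real_scalars : scalar_field R R
| Complex_scalars : scalar_field R R[i].

Definition closed_unit_ball (K : numFieldType) (X : normedModType K) : set X :=
  [set x | `|x| <= 1].

Arguments closed_unit_ball {K} X.

Definition bounded_operator (K : numFieldType) (X Y : normedModType K)
    (T : {linear X -> Y}) : Prop :=
  [bounded T x | x in closed_unit_ball X].

(* Norms take their values in K. For K = R[i], two elements are comparable only
   if their difference is real, so every upper (lower) bound of a nonempty set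
   of norms is real: the supremum (infimum) below, taken for the partial order
   of K, is the usual one of real numbers. *)
Definition opnorm (K : numFieldType) (X Y : normedModType K)
    (T : {linear X -> Y}) : K :=
  supremum 0 [set `|T x| | x in closed_unit_ball X].

Definition dist (K : numFieldType) (X : normedModType K) (x : X) (Z : set X) :
    K :=
  infimum 0 [set `|x - z| | z in Z].

Definition NA (K : numFieldType) (X Y : normedModType K)
    (T : {linear X -> Y}) : Prop :=
  exists2 x0, closed_unit_ball X x0 & `|T x0| = opnorm T.

Definition QNA (K : numFieldType) (X Y : normedModType K)
    (T : {linear X -> Y}) : Prop :=
  exists2 u, closure (T @` closed_unit_ball X) u & `|u| = opnorm T.

Definition linear_ker (K : numFieldType) (X Y : normedModType K)
    (T : {linear X -> Y}) : set X :=
  T @^-1` [set 0].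

Definition proximinal (K : numFieldType) (X : normedModType K) (Z : set X) :
    Prop :=
  forall x, exists2 z, Z z & `|x - z| = dist x Z.

(* Main.v *)
(* If u is in the closure of T(B_X) and |u| = ||T||, then u = T x because T(X) is
   closed. By the open mapping theorem for X -> T(X), a point a of B_X with T a
   close to u can be corrected by a small w so that T (a + w) = u; hence
   x - (a + w) is in ker T and dist(x, ker T) <= 1. A best approximation z of x in
   ker T gives x - z in B_X with T (x - z) = u. *)

Require Import Defs.
From HB Require Import structures.
From mathcomp Require Import all_boot all_order all_algebra.
From mathcomp Require Import all_classical all_reals topology normedtype.

Set Implicit Arguments.
Unset Strict Implicit.
Unset Printing Implicit Defensive.

Import Order.TTheory GRing.Theory Num.Theory.
Import numFieldNormedType.Exports.

Local Open Scope classical_set_scope.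
Local Open Scope ring_scope.

(** The case split on the scalars is confined to this lemma: all limit arguments below rest on the
    Archimedean property alone. In [R[i]] a norm is a nonnegative real, so a natural number
    exceeding its real part bounds it. *)
Lemma scalar_field_archimedean (R : realType) (K : numFieldType) :
  scalar_field R K -> Num.archimedean_axiom K.
Proof.
case=> x.
  by eexists; exact: archi_boundP (normr_ge0 x).
exists (Num.bound (complex.Re `|x|)).
have := normr_ge0 x; rewrite lecE ltcE /= => /andP[/eqP -> Re_ge0].
by rewrite -(rmorph_nat (real_complex R)) /= eqxx archi_boundP.
Qed.

Lemma halving_cvg0 (K : numFieldType) (r : nat -> K) :
  Num.archimedean_axiom K -> (forall n, 0 <= r n) ->
  (forall n, r n.+1 <= r n / 2) -> r @ \oo --> (0 : K).
Proof.
move=> archi r_ge0 r_half.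
(* Decay like 1/(n+1) suffices for the Archimedean argument; the induction rests on n + 2 <= 2(n +
   1). *)
have rM n : r n * n.+1%:R <= r 0%N.
  elim: n => [|n IHn]; first by rewrite mulr1.
  apply: le_trans IHn; apply: le_trans (ler_wpM2r _ (r_half n)) _; first by [].
  rewrite -mulrA ler_wpM2l// mulrC ler_pdivrMr// -natrM ler_nat.
  by rewrite muln2 -addnn addSn ltnS leq_addl.
apply/cvgrPdist_le => e e_gt0; have [N ltN] := archi (r 0%N / e).
exists N => // n /= leNn; rewrite sub0r normrN ger0_norm//.
rewrite -(ler_pM2r (ltr0Sn K n)); apply: le_trans (rM n) _.
rewrite mulrC -ler_pdivrMr//; apply: le_trans (_ : N%:R <= _).
  by rewrite -[leLHS]ger0_norm ?divr_ge0 ?(ltW ltN) ?(ltW e_gt0).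
by rewrite ler_nat ltnW.
Qed.

Lemma halving_steps_cvg (K : numFieldType) (V : completeNormedModType K)
    (u : nat -> V) (r : nat -> K) :
  Num.archimedean_axiom K -> (forall n, `|u n.+1 - u n| <= r n) ->
  (forall n, r n.+1 <= r n / 2) ->
  exists2 l, u @ \oo --> l & forall n, `|l - u n| <= 2 * r n.
Proof.
move=> archi u_step r_half.
have r_ge0 n : 0 <= r n := le_trans (normr_ge0 _) (u_step n).
(* The extra term reserves room for all later steps. The left side does not increase with [k], since
   a step costs at most [r (k + n)] and halving frees at least that much. *)
have tail n k : `|u (k + n)%N - u n| + 2 * r (k + n)%N <= 2 * r n.
  elim: k => [|k IHk]; first by rewrite subrr normr0 add0r.
  apply: le_trans IHk; rewrite addSn.
  have := r_half (k + n)%N; rewrite ler_pdivlMr// mulrC => r2.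
  rewrite -(subrKA (u (k + n)%N)) [2 * r (k + n)%N]mulr_natl mulr2n.
  apply: le_trans (lerD (ler_normD _ _) r2) _.
  have := lerD (lerD (u_step (k + n)%N) (lexx `|u (k + n)%N - u n|))
    (lexx (r (k + n)%N)).
  by rewrite [leRHS]addrAC [leRHS]addrC.
have u_near n m : (n <= m)%N -> `|u m - u n| <= 2 * r n.
  move=> lenm; have := tail n (m - n)%N; rewrite subnK//.
  by apply: le_trans; rewrite lerDl mulr_ge0.
have cvg_u : cvg (u @ \oo).
  apply: cauchy_cvg; apply: cauchy_exP => e e_gt0.
  have /cvgrPdist_lt/(_ (e / 2)) := halving_cvg0 archi r_ge0 r_half.
  rewrite divr_gt0// => /(_ isT)[N _ /(_ N (leqnn N))].
  rewrite /= sub0r normrN ger0_norm// ltr_pdivlMr// mulrC => rN.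
  exists (u N); exists N => // n /= leNn; rewrite -ball_normE /= distrC.
  exact: le_lt_trans (u_near _ _ leNn) rN.
exists (lim (u @ \oo)) => // n; apply/ler_addgt0Pr => e e_gt0.
have /cvgrPdist_le/(_ e e_gt0)[N _ uN] := cvg_u.
rewrite -(subrKA (u (maxn N n))) addrC; apply: le_trans (ler_normD _ _) _.
by apply: lerD; [apply: u_near; rewrite leq_maxr | apply: uN; rewrite /= leq_maxl].
Qed.

Lemma closureP_norm (K : numFieldType) (V : normedModType K) (A : set V) x :
  closure A x <-> forall e, 0 < e -> exists2 a, A a & `|x - a| < e.
Proof.
split=> [clA e e_gt0|clA B /nbhs_ballP[e /= e_gt0 sB]].
  by have [a [Aa]] := clA _ (nbhsx_ballx x _ e_gt0); rewrite -ball_normE; exists a.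
have [a Aa xa] := clA _ e_gt0; exists a; split=> //; apply: sB.
by rewrite -ball_normE.
Qed.

(* Unlike the library's [Baire], this covers complex scalars and closed sets [F]
   other than the whole space. *)
Lemma Baire_closed (K : numFieldType) (V : completeNormedModType K)
    (F : set V) (A : nat -> set V) :
  Num.archimedean_axiom K -> closed F -> F !=set0 -> F `<=` \bigcup_n A n ->
  exists n y r, [/\ F y, 0 < r &
    forall z, F z -> `|z - y| <= r -> closure (A n) z].
Proof.
move=> archi clF [y0 Fy0] FA; apply: contrapT => noball.
(* One step of the nested-ball construction, with its conditions as premises so that [choice] gives
   a total function. The avoided ball has radius [2 * q.2] because [halving_steps_cvg] puts the
   limit that close to the centre. *)
have step (p : nat * (V * K)) : exists q : V * K, F p.2.1 -> 0 < p.2.2 ->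
    [/\ F q.1, 0 < q.2, `|q.1 - p.2.1| <= p.2.2, q.2 <= p.2.2 / 2 &
     forall w, `|w - q.1| <= 2 * q.2 -> ~ A p.1 w].
  case: p => n [y r] /=.
  case: (pselect (F y /\ 0 < r)) => [[Fy r_gt0]|nFr]; last first.
    by exists (0, 0) => Fy r_gt0; case: nFr.
  have [z [Fz zy nAz]] : exists z, [/\ F z, `|z - y| <= r & ~ closure (A n) z].
    apply: contrapT => nz; apply: noball; exists n, y, r; split=> // z Fz zy.
    by apply: contrapT => nAz; apply: nz; exists z.
  have [d d_gt0 dA] : exists2 d, 0 < d & forall w, `|w - z| < d -> ~ A n w.
    apply: contrapT => nd; apply: nAz; apply/closureP_norm => e e_gt0.
    apply: contrapT => na; apply: nd; exists e => // w wz Aw; apply: na.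
    by exists w => //; rewrite distrC.
  have r2_gt0 : 0 < r / 2 by rewrite divr_gt0.
  have d3_gt0 : 0 < d / 3 by rewrite divr_gt0.
  have rd := real_comparable (gtr0_real r2_gt0) (gtr0_real d3_gt0).
  (* The bound [r / 2] gives the halving; [d / 3] keeps twice the radius below [d]. *)
  exists (z, Num.min (r / 2) (d / 3)) => _ _ /=; split=> //.
  - by rewrite comparable_lt_min// r2_gt0.
  - by rewrite comparable_ge_min// lexx.
  - move=> w wz; apply: dA; apply: le_lt_trans wz _.
    apply: le_lt_trans (_ : 2 * (d / 3) < _).
      by rewrite ler_wpM2l// comparable_ge_min// lexx orbT.
    by rewrite mulrCA -[ltRHS]mulr1 ltr_pM2l// ltr_pdivrMr// mul1r ltr_nat.
have [g gP] := choice step.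
pose s := fix s n := if n is n'.+1 then g (n', s n') else (y0, 1).
have sP n : F (s n).1 /\ 0 < (s n).2.
  by elim: n => [|n [Fn rn]] //=; have [] := gP (n, s n) Fn rn.
have {}gP n := gP (n, s n) (sP n).1 (sP n).2.
have [l sl lP] : exists2 l, (s n).1 @[n --> \oo] --> l &
    forall n, `|l - (s n).1| <= 2 * (s n).2.
  apply: (@halving_steps_cvg K V (fun n => (s n).1) (fun n => (s n).2)) => //.
    by move=> n; have [] := gP n.
  by move=> n; have [] := gP n.
have Fl : F l.
  by apply: (closed_cvg _ clF _ _ sl); apply: nearW => n; have [] := sP n.
have [n _ Al] := FA l Fl; have [_ _ _ _ /(_ l)] := gP n.
by apply=> //; exact: (lP n.+1).
Qed.

Lemma bounded_operator_continuous (K : numFieldType) (X Y : normedModType K)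
    (T : {linear X -> Y}) : bounded_operator T -> continuous T.
Proof.
move=> T_bounded; apply: bounded_linear_continuous.
apply: filterS T_bounded => M TM.
have : nbhs (0 : X) (closed_unit_ball X).
  apply/nbhs_ballP; exists 1; rewrite //= => x.
  by rewrite -ball_normE /= sub0r normrN => /ltW.
by apply: filterS => x; exact: TM.
Qed.

(** The Baire half of the open mapping theorem: the images of the balls of radius n + 1 cover the
    range, so the closure of one of them contains a relative ball around some [y0]. Subtracting
    approximations of [y0] and of [y0 + t *: y] moves the centre to 0. *)
Lemma closed_range_preimage_approx (K : numFieldType) (X : normedModType K)
    (Y : completeNormedModType K) (T : {linear X -> Y}) :
  Num.archimedean_axiom K -> closed (range T) ->
  exists2 M, 0 < M & forall y, range T y ->
    exists2 x, `|x| <= M * `|y| & `|y - T x| <= `|y| / 2.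
Proof.
move=> archi clT.
have [||n [y0 [r [[a0 _ Ta0] r_gt0 clB]]]] :=
    @Baire_closed K Y (range T)
      (fun n => T @` [set x | `|x| <= n.+1%:R]) archi clT.
- by exists (T 0); exists 0.
- move=> _ [x _ <-]; have [n xn] := archi `|x|.
  exists n => //; exists x => //=.
  by rewrite -[leLHS]normr_id (le_trans (ltW xn))// ler_nat.
exists (n.+1%:R *+ 2 / r) => [|y [a _ Ta]].
  by rewrite divr_gt0// -mulr_natr mulr_gt0.
have [->|y_neq0] := eqVneq y 0.
  by exists 0; rewrite ?linear0 ?addr0 !normr0 ?mulr0 ?mul0r ?lexx.
have y_gt0 : 0 < `|y| by rewrite normr_gt0.
(* Now [t *: y] has norm [r]. Two errors below [r / 4], divided by [t], total at most half the norm
   of [y]. *)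
pose t := r / `|y|; have t_gt0 : 0 < t by rewrite divr_gt0.
have e_gt0 : 0 < r / 2 / 2 by rewrite !divr_gt0.
have /closureP_norm/(_ _ e_gt0)[_ [b /= bn <-] bP] :
    closure (T @` [set x | `|x| <= n.+1%:R]) (y0 + t *: y).
  apply: clB; first by exists (a0 + t *: a) => //; rewrite linearD linearZ Ta0 Ta.
  by rewrite addrAC subrr add0r normrZ gtr0_norm// /t divfK ?gt_eqF.
have /closureP_norm/(_ _ e_gt0)[_ [c /= cn <-] cP] :
    closure (T @` [set x | `|x| <= n.+1%:R]) y0.
  by apply: clB; [exists a0 | rewrite subrr normr0 ltW].
have tVE : t^-1 = `|y| / r by rewrite /t invf_div.
exists (t^-1 *: (b - c)).
  rewrite normrZ gtr0_norm ?invr_gt0// tVE -mulrA [leRHS]mulrC ler_pM2l//.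
  rewrite mulrC ler_pM2r ?invr_gt0// mulr2n.
  exact: le_trans (ler_normB _ _) (lerD bn cn).
have -> : y - T (t^-1 *: (b - c)) =
    t^-1 *: ((y0 + t *: y - T b) - (y0 - T c)).
  rewrite linearZ linearB /= -[y in LHS](scalerK (lt0r_neq0 t_gt0)) -scalerBr.
  congr (_ *: _); rewrite opprB [LHS]addrC !opprB.
  by rewrite [RHS]addrC -!addrA; congr (_ + _); rewrite addrA addNr add0r addrC.
rewrite normrZ gtr0_norm ?invr_gt0// tVE -mulrA ler_pM2l// mulrC.
rewrite ler_pdivrMr// (le_trans (ler_normB _ _))//.
by rewrite mulrC [leRHS]splitr lerD// ltW.
Qed.

(** The completeness half: approximate preimages of the successive residuals [z n] are summed into
    [s n]. The residuals halve, so the partial sums converge in [X], and continuity of [T]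
    identifies the image of the limit. *)
Lemma closed_range_bounded_preimage (K : numFieldType)
    (X Y : completeNormedModType K) (T : {linear X -> Y}) :
  Num.archimedean_axiom K -> continuous T -> closed (range T) ->
  exists2 C, 0 < C & forall y, range T y -> exists2 x, T x = y & `|x| <= C * `|y|.
Proof.
move=> archi T_cont clT.
have [M M_gt0 approx] := @closed_range_preimage_approx K X Y T archi clT.
have /choice[g gP] (y : Y) : exists x, range T y ->
    `|x| <= M * `|y| /\ `|y - T x| <= `|y| / 2.
  case: (pselect (range T y)) => [/approx[x]|nTy]; first by exists x.
  by exists 0 => /nTy.
(* The factor 2 is that of [halving_steps_cvg] at index 0, where the partial sum is 0 and the
   residual is [y]. *)
exists (2 * M) => [|y Ty]; first by rewrite mulr_gt0.
pose z := fix z n := if n is n'.+1 then z n' - T (g (z n')) else y.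
pose s := fix s n := if n is n'.+1 then s n' + g (z n') else 0.
have Tz n : range T (z n).
  elim: n => [//|n [x _ Tx]] /=.
  by exists (x - g (z n)) => //; rewrite linearB Tx.
have Ts n : y - T (s n) = z n.
  elim: n => [|n IHn] /=; first by rewrite linear0 subr0.
  by rewrite linearD opprD addrA IHn.
have z_half n : `|z n.+1| <= `|z n| / 2 by have [] := gP _ (Tz n).
have [|n|l sl lP] := @halving_steps_cvg K X s (fun n => M * `|z n|) archi.
- by move=> n; rewrite /= addrAC subrr add0r; have [] := gP _ (Tz n).
- by rewrite -mulrA ler_pM2l.
exists l; last by have := lP 0%N; rewrite /= subr0 mulrA.
have /cvg_comp/(_ (T_cont l)) Tsl := sl.
apply: (cvg_unique (@norm_hausdorff _ _) Tsl).
have /cvgrPdist_le z0 : `|z n| @[n --> \oo] --> (0 : K).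
  by apply: halving_cvg0.
apply/cvgrPdist_le => e /z0; apply: filterS => n.
by rewrite sub0r normrN normr_id /= Ts.
Qed.

(* When the infimum does not exist, [dist] is the default value 0, for which the
   bound still holds. *)
Lemma dist_le (K : numFieldType) (X : normedModType K) (x : X) (Z : set X) z :
  Z z -> dist x Z <= `|x - z|.
Proof.
move=> Zz; rewrite /dist /infimum; case: ifP => [_|_]; first exact: normr_ge0.
by case: xgetP => [d _ [lb_d _]|_]; [apply: lb_d; exists z | exact: normr_ge0].
Qed.

Theorem proposition5p7 (R : realType) (K : numFieldType)
    (K_RC : scalar_field R K) (X Y : completeNormedModType K)
    (T : {linear X -> Y}) (T_bounded : bounded_operator T) (T_QNA : QNA T)
    (T_range : closed (range T)) (T_ker : proximinal (linear_ker T)) :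
  NA T.
Proof.
have archi := scalar_field_archimedean K_RC.
have [C C_gt0 CP] := closed_range_bounded_preimage archi
  (bounded_operator_continuous T_bounded) T_range.
have [u clu u_norm] := T_QNA.
have [x _ Tx] : range T u.
  by apply: T_range; apply: closure_subset clu => _ [x _ <-]; exists x.
have [z Tz xz] := T_ker x; exists (x - z); last first.
  by rewrite linearB Tz Tx subr0.
rewrite /closed_unit_ball /= xz; apply/ler_addgt0Pr => e e_gt0.
(* The tolerance [e / C] makes the correction [w] of norm at most [e]. *)
have [_ [a /= a_le1 <-] ua] : exists2 v, (T @` closed_unit_ball X) v &
    `|u - v| < e / C.
  by move/closureP_norm: clu; apply; rewrite divr_gt0.
have [|w Tw w_le] := CP (u - T a).
  by exists (x - a) => //; rewrite linearB Tx.
have ker_xaw : linear_ker T (x - (a + w)).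
  by rewrite /linear_ker /= linearB linearD Tx Tw addrCA subrr addr0 subrr.
apply: le_trans (dist_le x ker_xaw) _.
rewrite subKr (le_trans (ler_normD _ _))// lerD// (le_trans w_le)//.
by rewrite mulrC -ler_pdivlMr// ltW.
Qed.
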